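(* Consider the complex-tetrad reduced vacuum field equations (context) with $\mathcal{A}(\psi)\equiv\alpha$ a nonzero constant, and arbitrary $\beta$, $\kappa$, $\tilde{\mathcal{C}}$, $\mathcal{V}$. Let $A,C,\psi$ be smooth functions on an open interval $I\subset(0,\infty)$ with $A,C$ nowhere zero, satisfying $E^{(2)}_{tt}=0$ and $E^{(2)}_{\vartheta\vartheta}=0$ on $I$. Then $$rA(A-rA')\,C'+C\big(C^2-A^2+r^2A'^2+r^2AA''\big)=0\quad\text{on } I .$$ In particular, if $C\equiv1$ then there exist constants $M,\Lambda$ with $A(r)^2=1-\frac{2M}{r}-\Lambda r^2$ on $I$, i.e. the metric is Schwarzschild–(anti-)de Sitter, for every choice of $\tilde{\mathcal{C}}$ and $\mathcal{V}$.
   Context: Metric ansatz ${\rm d}s^2=A(r)^2{\rm d}t^2-\frac{C(r)^2}{A(r)^2}{\rm d}r^2-r^2{\rm d}\Omega^2$, scalar field $\psi=\psi(r)$. Primes on $A,C,\psi$ are $r$-derivatives; $\mathcal{A}',\tilde{\mathcal{C}}',\tilde{\mathcal{C}}'',\mathcal{V}'$ are $\psi$-derivatives evaluated at $\psi(r)$. The complex-tetrad reduced vacuum field equations of the scalar-torsion theory are: $E^{(2)}_{tt}:\ 0=\mathcal{A}\frac{A^2(-2rACA'-A^2(C-2rC')+C^3)}{r^2C^3}+\tilde{\mathcal{C}}'\frac{A^3(C(A'\psi'+A\psi'')-AC'\psi')}{C^3}-\frac{2A^4\psi'\mathcal{A}'}{rC^2}+\frac{A^4\psi'^2\tilde{\mathcal{C}}''}{C^2}-\frac{\beta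 A^4\psi'^2}{2C^2}+\kappa^2A^2\mathcal{V}$; $E^{(2)}_{rr}:\ 0=\frac{\mathcal{A}(-2rAA'-A^2+C^2)}{r^2A^2}+\big(\frac{A'}{A}+\frac2r\big)\psi'\tilde{\mathcal{C}}'+\frac{\kappa^2C^2\mathcal{V}}{A^2}+\frac12\beta\psi'^2$; $E^{(2)}_{\vartheta\vartheta}:\ 0=-\mathcal{A}'\frac{A(rA'+A)\psi'}{rC^2}+\tilde{\mathcal{C}}'\frac{A(C(A'\psi'+A\psi'')-AC'\psi')}{C^3}+\frac{\mathcal{A}(-rCA'^2+A(rA'C'-C(rA''+2A'))+A^2C')}{rC^3}+\frac{A^2\psi'^2\tilde{\mathcal{C}}''}{C^2}-\frac{\beta A^2\psi'^2}{2C^2}+\kappa^2\mathcal{V}$; $E^{(2)}_{\psi}:\ 0=\frac{(2rAA'+A^2+C^2)\mathcal{A}'}{r^2C^2}+\frac{\beta A(2rCA'\psi'+A(C(r\psi''+2\psi')-rC'\psi'))}{rC^3}+\frac{\tilde{\mathcal{C}}'(r^2CA'^2+rA(C(rA''+6A')-rA'C')+2A^2(C-rC'))}{r^2C^3}+\kappa^2\mathcal{V}'$. *)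

(* Defs.v *)
From Stdlib Require Import Reals.
From Coquelicot Require Import Coquelicot.
Open Scope R_scope.

Definition smooth_on (D : R -> Prop) (f : R -> R) : Prop :=
  forall (n : nat) (x : R), D x -> ex_derive_n f n x.

Definition in_interval (a b : Rbar) (r : R) : Prop :=
  Rbar_lt a r /\ Rbar_lt r b.

(* E^(2)_tt, evaluated at r.  calA, Ct, V are functions of psi; their primes
   are psi-derivatives evaluated at psi(r).  Primes on A, C, psi are r-derivatives. *)
Definition E_tt (calA Ct V : R -> R) (beta kappa : R) (A C psi : R -> R) (r : R) : R :=
  let a := A r in let a1 := Derive A r in
  let c := C r in let c1 := Derive C r in
  let p1 := Derive psi r in let p2 := Derive (Derive psi) r in
  let cA := calA (psi r) in let cA1 := Derive calA (psi r) in
  let ct1 := Derive Ct (psi r) in let ct2 := Derive (Derive Ct) (psi r) in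
  let v := V (psi r) in
  cA * (a^2 * (- 2 * r * a * c * a1 - a^2 * (c - 2 * r * c1) + c^3)) / (r^2 * c^3)
  + ct1 * (a^3 * (c * (a1 * p1 + a * p2) - a * c1 * p1)) / c^3
  - 2 * a^4 * p1 * cA1 / (r * c^2)
  + a^4 * p1^2 * ct2 / c^2
  - beta * a^4 * p1^2 / (2 * c^2)
  + kappa^2 * a^2 * v.

Definition E_thth (calA Ct V : R -> R) (beta kappa : R) (A C psi : R -> R) (r : R) : R :=
  let a := A r in let a1 := Derive A r in let a2 := Derive (Derive A) r in
  let c := C r in let c1 := Derive C r in
  let p1 := Derive psi r in let p2 := Derive (Derive psi) r in
  let cA := calA (psi r) in let cA1 := Derive calA (psi r) in
  let ct1 := Derive Ct (psi r) in let ct2 := Derive (Derive Ct) (psi r) in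
  let v := V (psi r) in
  - cA1 * (a * (r * a1 + a) * p1) / (r * c^2)
  + ct1 * (a * (c * (a1 * p1 + a * p2) - a * c1 * p1)) / c^3
  + cA * (- r * c * a1^2 + a * (r * a1 * c1 - c * (r * a2 + 2 * a1)) + a^2 * c1) / (r * c^3)
  + a^2 * p1^2 * ct2 / c^2
  - beta * a^2 * p1^2 / (2 * c^2)
  + kappa^2 * v.

(* Main.v *)
Require Import Defs.
From Stdlib Require Import Reals Lra Classical.
From Coquelicot Require Import Coquelicot.
Open Scope R_scope.

(* With a constant coupling function the scalar-field terms of E_tt and A^2 E_thth
   coincide (both kinetic and potential parts), so E_tt - A^2 E_thth is purely
   geometric: alpha A^2 / (r^2 C^3) times the stated constraint.  When C = 1 the
   constraint becomes the Euler equation r^2 g'' = 2 g for g = A^2 - 1, whose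
   solutions on r > 0 are spanned by 1/r and r^2. *)

Definition metric_constraint (A C : R -> R) (r : R) : R :=
  r * A r * (A r - r * Derive A r) * Derive C r
  + C r * ((C r)^2 - (A r)^2 + r^2 * (Derive A r)^2 + r^2 * A r * Derive (Derive A) r).

Lemma E_tt_sub_E_thth (alpha beta kappa : R) (Ct V A C psi : R -> R) (r : R) :
  r <> 0 -> C r <> 0 ->
  E_tt (fun _ => alpha) Ct V beta kappa A C psi r
  - (A r)^2 * E_thth (fun _ => alpha) Ct V beta kappa A C psi r
  = alpha * (A r)^2 * metric_constraint A C r / (r^2 * (C r)^3).
Proof.
  intros Hr HC.
  unfold E_tt, E_thth, metric_constraint; rewrite Derive_const.
  field; auto.
Qed.

Lemma metric_constraint_of_field_eqs (alpha beta kappa : R) (Ct V A C psi : R -> R) (r : R) :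
  alpha <> 0 -> r <> 0 -> A r <> 0 -> C r <> 0 ->
  E_tt (fun _ => alpha) Ct V beta kappa A C psi r = 0 ->
  E_thth (fun _ => alpha) Ct V beta kappa A C psi r = 0 ->
  metric_constraint A C r = 0.
Proof.
  intros Hal Hr HA HC Ett Eth.
  pose proof (E_tt_sub_E_thth alpha beta kappa Ct V A C psi r Hr HC) as Hdiff.
  rewrite Ett, Eth in Hdiff.
  assert (Hden : r^2 * (C r)^3 <> 0) by (apply Rmult_integral_contrapositive; split;
    apply pow_nonzero; assumption).
  assert (Hnum : alpha * (A r)^2 * metric_constraint A C r = 0).
  { apply (Rmult_eq_reg_r (/ (r^2 * (C r)^3))); [|now apply Rinv_neq_0_compat].
    unfold Rdiv in Hdiff; lra. }
  apply Rmult_integral in Hnum as [Hnum|]; [|assumption].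
  apply Rmult_integral in Hnum as [|Hnum]; [contradiction|].
  exfalso; exact (pow_nonzero (A r) 2 HA Hnum).
Qed.

Section Interval.

Variables a b : Rbar.

Lemma in_interval_locally (r : R) : in_interval a b r -> locally r (in_interval a b).
Proof. exact (open_and _ _ (open_Rbar_gt a) (open_Rbar_lt b) r). Qed.

Lemma in_interval_between (r1 r2 x : R) :
  in_interval a b r1 -> in_interval a b r2 -> r1 <= x <= r2 -> in_interval a b x.
Proof. unfold in_interval; destruct a, b; simpl; intros; lra. Qed.

Lemma in_interval_gt0 (r : R) : Rbar_le (Finite 0) a -> in_interval a b r -> 0 < r.
Proof. unfold in_interval; destruct a; simpl; intros; tauto || lra. Qed.

Lemma is_derive_0_const_on (F : R -> R) :
  (forall r, in_interval a b r -> is_derive F r 0) ->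
  forall r1 r2, in_interval a b r1 -> in_interval a b r2 -> F r1 = F r2.
Proof.
  intros HD r1 r2 H1 H2.
  assert (Hin : forall x, Rmin r1 r2 <= x <= Rmax r1 r2 -> in_interval a b x).
  { intros x Hx; destruct (Rle_dec r1 r2).
    - rewrite Rmin_left, Rmax_right in Hx by lra; exact (in_interval_between r1 r2 x H1 H2 Hx).
    - rewrite Rmin_right, Rmax_left in Hx by lra; exact (in_interval_between r2 r1 x H2 H1 Hx). }
  destruct (MVT_gen F r1 r2 (fun _ => 0)) as [c [_ Hc]].
  - intros x Hx; apply HD, Hin; lra.
  - intros x Hx; apply (derivable_continuous_pt F x).
    exists 0; apply is_derive_Reals, HD, Hin; lra.
  - lra.
Qed.

Hypothesis a_ge0 : Rbar_le (Finite 0) a.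

(* Both first integrals come from the Wronskians of g with the solutions r^2 and 1/r. *)
Lemma euler_ode_solution (g g1 g2 : R -> R) :
  (forall r, in_interval a b r -> is_derive g r (g1 r)) ->
  (forall r, in_interval a b r -> is_derive g1 r (g2 r)) ->
  (forall r, in_interval a b r -> r^2 * g2 r = 2 * g r) ->
  exists M Lambda : R, forall r, in_interval a b r -> g r = - 2 * M / r - Lambda * r^2.
Proof.
  intros Dg Dg1 Euler.
  destruct (classic (exists r0, in_interval a b r0)) as [[r0 Hr0]|Hempty].
  2: { exists 0, 0; intros r Hr; exfalso; eauto. }
  set (Q := fun r => (g r + r * g1 r) / (3 * r^2)).
  set (P := fun r => r * (2 * g r - r * g1 r) / 3).
  assert (DQ : forall r, in_interval a b r -> is_derive Q r 0).
  { intros r Hr; pose proof (in_interval_gt0 r a_ge0 Hr).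
    unfold Q; auto_derive.
    - repeat split; try (eexists; eauto); nra.
    - change (fun x => g x) with g; change (fun x => g1 x) with g1.
      rewrite (is_derive_unique _ _ _ (Dg r Hr)), (is_derive_unique _ _ _ (Dg1 r Hr)).
      replace (g r) with (r^2 * g2 r / 2) by (rewrite (Euler r Hr); field).
      field; lra. }
  assert (DP : forall r, in_interval a b r -> is_derive P r 0).
  { intros r Hr; unfold P; auto_derive.
    - repeat split; eexists; eauto.
    - change (fun x => g x) with g; change (fun x => g1 x) with g1.
      rewrite (is_derive_unique _ _ _ (Dg r Hr)), (is_derive_unique _ _ _ (Dg1 r Hr)).
      replace (g r) with (r^2 * g2 r / 2) by (rewrite (Euler r Hr); field).
      field. }
  exists (- P r0 / 2), (- Q r0); intros r Hr.
  pose proof (in_interval_gt0 r a_ge0 Hr).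
  rewrite <- (is_derive_0_const_on Q DQ r r0 Hr Hr0), <- (is_derive_0_const_on P DP r r0 Hr Hr0).
  unfold P, Q; field; lra.
Qed.

Lemma schwarzschild_de_sitter_of_constraint (A : R -> R) :
  smooth_on (in_interval a b) A ->
  (forall r, in_interval a b r -> metric_constraint A (fun _ => 1) r = 0) ->
  exists M Lambda : R, forall r, in_interval a b r ->
    (A r)^2 = 1 - 2 * M / r - Lambda * r^2.
Proof.
  intros HA Hcon.
  destruct (euler_ode_solution (fun r => (A r)^2 - 1) (fun r => 2 * A r * Derive A r)
              (fun r => 2 * ((Derive A r)^2 + A r * Derive (Derive A) r)))
    as [M [Lambda HM]].
  - intros r Hr; pose proof (HA 1%nat r Hr); auto_derive; auto.
    change (fun x => A x) with A; ring.
  - intros r Hr; pose proof (HA 1%nat r Hr); pose proof (HA 2%nat r Hr).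
    auto_derive; auto.
    change (fun x => A x) with A; change (fun x => Derive A x) with (Derive A); ring.
  - intros r Hr; pose proof (Hcon r Hr) as Hc.
    unfold metric_constraint in Hc; rewrite Derive_const in Hc; lra.
  - exists M, Lambda; intros r Hr; pose proof (HM r Hr); unfold Rdiv in *; lra.
Qed.

End Interval.

Theorem mainTheorem2
  (alpha beta kappa : R) (Ct V : R -> R) (a b : Rbar) (A C psi : R -> R) :
  alpha <> 0 ->
  Rbar_le (Finite 0) a -> Rbar_lt a b ->
  smooth_on (fun _ => True) Ct ->
  smooth_on (fun _ => True) V ->
  smooth_on (in_interval a b) A ->
  smooth_on (in_interval a b) C ->
  smooth_on (in_interval a b) psi ->
  (forall r, in_interval a b r -> A r <> 0) ->
  (forall r, in_interval a b r -> C r <> 0) ->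
  (forall r, in_interval a b r -> E_tt (fun _ => alpha) Ct V beta kappa A C psi r = 0) ->
  (forall r, in_interval a b r -> E_thth (fun _ => alpha) Ct V beta kappa A C psi r = 0) ->
  (forall r, in_interval a b r ->
     r * A r * (A r - r * Derive A r) * Derive C r
     + C r * ((C r)^2 - (A r)^2 + r^2 * (Derive A r)^2 + r^2 * A r * Derive (Derive A) r) = 0)
  /\
  ((forall r, in_interval a b r -> C r = 1) ->
   exists M Lambda : R, forall r, in_interval a b r ->
     (A r)^2 = 1 - 2 * M / r - Lambda * r^2).
Proof.
  intros Hal Ha _ _ _ HA _ _ HA0 HC0 Ett Eth.
  assert (Hcon : forall r, in_interval a b r -> metric_constraint A C r = 0).
  { intros r Hr; pose proof (in_interval_gt0 a b r Ha Hr).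
    apply (metric_constraint_of_field_eqs alpha beta kappa Ct V A C psi r);
      auto with real. }
  split; [exact Hcon|].
  intros HC1; apply (schwarzschild_de_sitter_of_constraint a b Ha A HA).
  intros r Hr; rewrite <- (Hcon r Hr); unfold metric_constraint.
  rewrite (HC1 r Hr), (Derive_ext_loc C (fun _ => 1)); [reflexivity|].
  exact (filter_imp _ _ HC1 (in_interval_locally a b r Hr)).
Qed.
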